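(* Let $\Omega \subset \mathbb{R}^N$ be an open, bounded, convex domain (in particular nonempty). Then $$\mu_1(\Omega) \leq \frac{\pi^2}{[\mathrm{diam}(\Omega)]^2}.$$
   Context: For a symmetric $N\times N$ matrix $X$, $\lambda_1(X)\le \dots\le \lambda_N(X)$ denote its ordered eigenvalues, so $\lambda_N(X)$ is the largest one. For an open, bounded, nonempty set $\Omega\subset\mathbb{R}^N$, the principal eigenvalue of the operator $-\lambda_N(D^2 u)$ with Dirichlet boundary conditions is defined by $$\mu_1(\Omega) := \sup \{ \mu \in \mathbb{R} : \exists\, \varphi \in LSC(\Omega),\ \varphi > 0 \text{ in }\Omega, \text{ such that } -\lambda_N(D^2 \varphi) \geq \mu \varphi \text{ in } \Omega\},$$ where $LSC(\Omega)$ is the set of lower semicontinuous real functions on $\Omega$ and the inequality is understood in the viscosity sense: for every $x_0\in\Omega$ and every $C^2$ function $\psi$ defined near $x_0$ such that $\varphi-\psi$ has a local minimum at $x_0$ with $\varphi(x_0)=\psi(x_0)$, one has $-\lambda_N(D^2\psi(x_0))\ge \mu\,\varphi(x_0)$. The diameter is $\mathrm{diam}(\Omega)=\sup\{|x-y| : x,y\in\Omega\}$. *)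

(* Defs.v *)
From HB Require Import structures.
From mathcomp Require Import all_boot all_order all_algebra.
From mathcomp Require Import all_classical all_reals all_analysis.
Set Implicit Arguments.
Unset Strict Implicit.
Unset Printing Implicit Defensive.
Import Order.TTheory GRing.Theory Num.Theory.
Import numFieldNormedType.Exports.
Local Open Scope classical_set_scope.
Local Open Scope ring_scope.

(* Points of R^N are row vectors. The library's norm on 'rV[R]_N is the sup
   norm: it has the same open and bounded sets as the Euclidean norm, but not
   the same diameters, hence [enorm] below. *)

Definition enorm (R : realType) (N : nat) (x : 'rV[R]_N) : R :=
  Num.sqrt (\sum_(i < N) x ord0 i ^+ 2).

Definition diam (R : realType) (N : nat) (Omega : set 'rV[R]_N) : R :=
  sup [set enorm (x - y) | x in Omega & y in Omega].

(* The largest eigenvalue lambda_N(X). For X symmetric and N > 0 the set of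
   eigenvalues is finite and nonempty, so that the supremum is a maximum. *)
Definition lambda_max (R : realType) (N : nat) (X : 'M[R]_N) : R :=
  sup [set a | eigenvalue X a].

Definition partial (R : realType) (N : nat) (i : 'I_N) (f : 'rV[R]_N -> R)
    : 'rV[R]_N -> R :=
  fun x => 'D_(delta_mx ord0 i) f x.

Definition hessian (R : realType) (N : nat) (f : 'rV[R]_N -> R)
    (x : 'rV[R]_N) : 'M[R]_N :=
  \matrix_(i < N, j < N) partial i (partial j f) x.

Definition C2_near (R : realType) (N : nat) (f : 'rV[R]_N -> R)
    (x0 : 'rV[R]_N) : Prop :=
  \forall x \near x0,
    [/\ {for x, continuous f},
        forall i : 'I_N,
          derivable f x (delta_mx ord0 i) /\
          {for x, continuous (partial i f)} &
        forall i j : 'I_N,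
          derivable (partial j f) x (delta_mx ord0 i) /\
          {for x, continuous (partial i (partial j f))}].

(* Functions on Omega are represented by total functions of which only the
   values on Omega matter. *)
Definition LSC (R : realType) (N : nat) (Omega : set 'rV[R]_N)
    (phi : 'rV[R]_N -> R) : Prop :=
  lower_semicontinuous (fun x : subspace Omega => (phi x)%:E).

(* - lambda_N(D^2 phi) >= mu phi in Omega, in the viscosity sense. *)
Definition viscosity_supersolution (R : realType) (N : nat)
    (Omega : set 'rV[R]_N) (mu : R) (phi : 'rV[R]_N -> R) : Prop :=
  forall (x0 : 'rV[R]_N) (psi : 'rV[R]_N -> R),
    Omega x0 -> C2_near psi x0 ->
    (\forall x \near x0, phi x0 - psi x0 <= phi x - psi x) ->
    phi x0 = psi x0 ->
    mu * phi x0 <= - lambda_max (hessian psi x0).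

Definition mu1 (R : realType) (N : nat) (Omega : set 'rV[R]_N) : \bar R :=
  ereal_sup [set mu%:E | mu in [set mu : R |
    exists phi : 'rV[R]_N -> R,
      [/\ LSC Omega phi,
          forall x, Omega x -> 0 < phi x &
          viscosity_supersolution Omega mu phi]]].

(* Main.v *)
Require Import Defs.
From HB Require Import structures.
From mathcomp Require Import all_boot all_order all_algebra.
From mathcomp Require Import all_classical all_reals all_analysis.
From mathcomp Require Import ring lra.
Set Implicit Arguments.
Unset Strict Implicit.
Unset Printing Implicit Defensive.
Import Order.TTheory GRing.Theory Num.Theory.
Import numFieldNormedType.Exports.
Local Open Scope classical_set_scope.
Local Open Scope ring_scope.

(** A supersolution of - lambda_N(D^2 phi) >= mu phi is, in every direction, a
    supersolution of the one-dimensional inequality - phi'' >= mu phi.  On a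
    segment of length l inside Omega, the sine arch sin(pi s / l) vanishes at
    both ends, and Sturm comparison with a positive phi forces
    mu <= (pi / l)^2.  Taking the supremum over the segments with endpoints in
    Omega, which convexity places inside Omega, replaces l by the diameter.

    To run this comparison with viscosity tests, which have to be smooth
    functions of all N variables, the arch is thickened.  Let e be the unit
    direction of the segment from x to y, s(z) = <z - x, e> the height of z
    along it and q(z) the squared distance of z to the axis.  The barrier
      h(z) = sin(pi s(z) / l) (1 - q(z) / r^2)
    is nonnegative on the tube 0 <= s <= l, q <= r^2, and zero on the boundary
    of the tube; a thin tube lies in Omega ([exists_tube]).  Since phi is
    positive and lower semicontinuous, h / phi attains its maximum M > 0 on the
    compact tube ([ratio_attains_max]), at a point x0 where h > 0, hence in
    the interior of the tube ([tube_nbhs_of_barrier_gt0]).  So h / M touches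
    phi from below at x0.

    The cutoff depends only on the directions orthogonal to e and enters as a
    factor, so that D^2 h e . e = - (pi / l)^2 h at every point, whatever the
    position of x0 relative to the axis ([hessian_barrier_axis]).  In general e
    is not an eigenvector of D^2 h, but the Rayleigh principle
    ([rayleigh_le_lambda_max]) bounds lambda_N from below by the quadratic form
    in direction e.  Testing the supersolution property with h / M then yields
    mu phi(x0) <= (pi / l)^2 phi(x0). *)

(** * Pointwise continuity *)

Section PointwiseContinuity.
Context {R : realType} {T : topologicalType}.
Implicit Types f g : T -> R.

Lemma continuous_mul f g : continuous f -> continuous g ->
  continuous (fun t => f t * g t).
Proof. by move=> cf cg t; exact: cvgM (cf t) (cg t). Qed.

Lemma continuous_add f g : continuous f -> continuous g ->
  continuous (fun t => f t + g t).
Proof. by move=> cf cg t; exact: cvgD (cf t) (cg t). Qed.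

Lemma continuous_opp f : continuous f -> continuous (fun t => - f t).
Proof. by move=> cf t; exact: cvgN (cf t). Qed.

Lemma continuous_postcomp (h : R -> R) f : continuous h -> continuous f ->
  continuous (fun t => h (f t)).
Proof. by move=> ch cf t; apply: continuous_comp; [exact: cf|exact: ch]. Qed.

Lemma continuous_sum n (F : 'I_n -> T -> R) : (forall i, continuous (F i)) ->
  continuous (fun t => \sum_i F i t).
Proof.
move=> cF; apply: continuous_big => [|i _]; first exact: add_continuous.
exact: cF.
Qed.

End PointwiseContinuity.

(** * The Euclidean inner product on row vectors *)

Section Dot.
Variables (R : realType) (N : nat).
Implicit Types (u v w x z : 'rV[R]_N) (M : 'M[R]_N).

Definition dot u v : R := (u *m v^T) ord0 ord0.

Lemma dotE u v : dot u v = \sum_i u ord0 i * v ord0 i.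
Proof. by rewrite /dot mxE; apply: eq_bigr => i _; rewrite mxE. Qed.

Lemma dotC u v : dot u v = dot v u.
Proof. by rewrite !dotE; apply: eq_bigr => i _; rewrite mulrC. Qed.

Lemma dotDl u v w : dot (u + v) w = dot u w + dot v w.
Proof. by rewrite /dot mulmxDl mxE. Qed.

Lemma dotDr u v w : dot w (u + v) = dot w u + dot w v.
Proof. by rewrite ![dot w _]dotC dotDl. Qed.

Lemma dotZl a u v : dot (a *: u) v = a * dot u v.
Proof. by rewrite /dot -scalemxAl mxE. Qed.

Lemma dotZr a u v : dot v (a *: u) = a * dot v u.
Proof. by rewrite ![dot v _]dotC dotZl. Qed.

Lemma dotNl u v : dot (- u) v = - dot u v.
Proof. by rewrite -scaleN1r dotZl mulN1r. Qed.

Lemma dotNr u v : dot v (- u) = - dot v u.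
Proof. by rewrite ![dot v _]dotC dotNl. Qed.

Lemma dot_mulmxl u v M : dot (u *m M) v = dot u (v *m M^T).
Proof. by rewrite /dot trmx_mul trmxK mulmxA. Qed.

Lemma dot_delta u i : dot u (delta_mx ord0 i) = u ord0 i.
Proof.
rewrite dotE (bigD1 i)//= mxE !eqxx mulr1 big1 ?addr0// => j ji.
by rewrite mxE (negPf ji) andbF mulr0.
Qed.

Lemma dot_ge0 u : 0 <= dot u u.
Proof. by rewrite dotE; apply: sumr_ge0 => i _; rewrite -expr2 sqr_ge0. Qed.

Lemma sqr_coord_le_dot u i : u ord0 i ^+ 2 <= dot u u.
Proof.
rewrite dotE (bigD1 i)//= -expr2 lerDl.
by apply: sumr_ge0 => j _; rewrite -expr2 sqr_ge0.
Qed.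

Lemma dot_eq0 u : dot u u = 0 -> u = 0.
Proof.
move=> u0; apply/rowP => i; rewrite mxE; apply/eqP.
by rewrite -sqrf_eq0 eq_le sqr_ge0 andbT -u0 sqr_coord_le_dot.
Qed.

Lemma enorm_dot u : enorm u ^+ 2 = dot u u.
Proof.
rewrite /enorm sqr_sqrtr; last by apply: sumr_ge0 => i _; rewrite sqr_ge0.
by rewrite dotE; apply: eq_bigr => i _; rewrite expr2.
Qed.

(** Compares the sup norm, which defines the topology, with the Euclidean
    norm. *)
Lemma mx_norm_le u (r : R) : 0 <= r -> dot u u <= r ^+ 2 -> `|u| <= r.
Proof.
move=> r0 ur; rewrite [leLHS]/Num.Def.normr /= mx_normrE.
apply/bigmax_leP; split=> //= -[i j] _ /=; rewrite (ord1 i).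
rewrite -ler_sqr ?nnegrE// real_normK ?num_real//.
exact: le_trans (sqr_coord_le_dot _ _) ur.
Qed.

Lemma mulmx_coord z M i : (z *m M) ord0 i = dot z (delta_mx ord0 i *m M^T).
Proof. by rewrite -dot_delta dot_mulmxl. Qed.

Lemma coord_rV_continuous i : continuous (fun z : 'rV[R]_N => z ord0 i).
Proof. exact: coord_continuous. Qed.

Lemma dotl_continuous v : continuous (fun z : 'rV[R]_N => dot z v).
Proof.
rewrite [X in continuous X](_ : _ =
    fun z : 'rV[R]_N => \sum_i z ord0 i * v ord0 i).
  by apply: continuous_sum => i; apply: continuous_mul;
    [exact: coord_rV_continuous|exact: cst_continuous].
by apply/funext => z; rewrite dotE.
Qed.

Lemma quad_form_continuous M : continuous (fun z : 'rV[R]_N => dot (z *m M) z).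
Proof.
rewrite [X in continuous X](_ : _ = fun z : 'rV[R]_N =>
    \sum_i dot z (delta_mx ord0 i *m M^T) * z ord0 i).
  by apply: continuous_sum => i; apply: continuous_mul;
    [exact: dotl_continuous|exact: coord_rV_continuous].
by apply/funext => y; rewrite dotE; apply: eq_bigr => i _; rewrite mulmx_coord.
Qed.

End Dot.

(** * The Rayleigh principle *)

(** With u = v B, the form at v + t u is 2 t |u|^2 + O(t^2), which takes
    negative values for small t < 0 unless u = 0. *)
Lemma psd_kernel (R : realType) N (B : 'M[R]_N) (v : 'rV[R]_N) :
  B^T = B -> (forall u, 0 <= dot (u *m B) u) -> dot (v *m B) v = 0 ->
  v *m B = 0.
Proof.
move=> Bsym Bge0 Bv0; apply: dot_eq0; set u := v *m B.
have psd t : 0 <= 2 * t * dot u u + t ^+ 2 * dot (u *m B) u.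
  have := Bge0 (v + t *: u).
  rewrite mulmxDl -scalemxAl !(dotDl, dotDr, dotZl, dotZr) Bv0.
  rewrite -/u (dot_mulmxl u v) Bsym -/u => /le_trans; apply.
  by rewrite le_eqVlt; apply/orP; left; apply/eqP; ring.
have D0 := dot_ge0 u; set D := dot u u in psd D0 *.
have C0 := Bge0 u; set C := dot (u *m B) u in psd C0.
apply/eqP; rewrite eq_le D0 andbT.
have C1 : 0 < C + 1 by lra.
(* a negative t small enough for the linear term to dominate; the + 1
   covers the case C = 0 *)
have := psd (- (D / (C + 1))).
have -> : 2 * - (D / (C + 1)) * D + (- (D / (C + 1))) ^+ 2 * C =
   - (D ^+ 2 * ((C + 2) / (C + 1) ^+ 2)).
  by field; rewrite gt_eqF.
rewrite oppr_ge0 pmulr_lle0; last first.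
  by rewrite divr_gt0 ?exprn_gt0//; lra.
by nra.
Qed.

(** Let v maximise the quadratic form of H on the unit sphere, with value l.
    Then l - H is positive semidefinite and vanishes at v, so that v is an
    eigenvector for l; and no eigenvalue exceeds l, so that the supremum which
    defines [lambda_max H] is taken over a bounded set and is at least l. *)
Lemma rayleigh_le_lambda_max (R : realType) N (H : 'M[R]_N) (e : 'rV[R]_N) :
  H^T = H -> dot e e = 1 -> dot (e *m H) e <= lambda_max H.
Proof.
move=> Hsym e1; pose S := [set u : 'rV[R]_N | dot u u = 1].
have cdot : continuous (fun u : 'rV[R]_N => dot u u).
  under eq_fun do rewrite -[X in dot X _]mulmx1.
  exact: quad_form_continuous.
have cS : compact S.
  apply: bounded_closed_compact.
    exists 1; split => // r r1 u Su; apply: le_trans (ltW r1).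
    by apply: mx_norm_le => //; rewrite Su expr1n.
  have -> : S = (fun u : 'rV[R]_N => dot u u) @^-1` [set 1] by [].
  by apply: closed_comp => [u _|]; [exact: cdot|exact: closed_eq].
have [v /set_mem vS vmax] : exists2 v, v \in S &
    forall u, u \in S -> dot (u *m H) u <= dot (v *m H) v.
  apply: compact_EVT_max => //; first by exists e.
  by apply: continuous_subspaceT; exact: quad_form_continuous.
set l := dot (v *m H) v in vmax.
have Hle u : dot (u *m H) u <= l * dot u u.
  have [->|u0] := eqVneq u 0.
    by rewrite mul0mx -(scale0r 0) !dotZl !mul0r mulr0.
  have du : 0 < dot u u.
    rewrite lt_neqAle dot_ge0 andbT eq_sym.
    by apply: contra u0 => /eqP /dot_eq0 ->.
  have := vmax ((Num.sqrt (dot u u))^-1 *: u).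
  have sq : (Num.sqrt (dot u u))^-1 * (Num.sqrt (dot u u))^-1 = (dot u u)^-1.
    by rewrite -invfM -expr2 sqr_sqrtr// ltW.
  rewrite -scalemxAl !dotZl !dotZr !mulrA sq mulrC ler_pdivrMr//; apply.
  by apply/mem_set; rewrite /S /= dotZl dotZr mulrA sq mulVf// gt_eqF.
have vl : v *m H = l *: v.
  have : v *m (l%:M - H) = 0.
    apply: psd_kernel => [|u|]; first by rewrite linearB /= tr_scalar_mx Hsym.
      by rewrite mulmxBr mul_mx_scalar dotDl dotNl dotZl subr_ge0.
    by rewrite mulmxBr mul_mx_scalar dotDl dotNl dotZl vS mulr1 subrr.
  by rewrite mulmxBr mul_mx_scalar => /eqP; rewrite subr_eq0 => /eqP ->.
apply: (@le_trans _ _ l); first by apply: vmax; exact/mem_set.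
apply: ub_le_sup; last first.
  apply/eigenvalueP; exists v => //; apply/eqP => v0.
  move: vS; rewrite /S /= v0 -(scale0r 0) dotZl mul0r => /esym/eqP.
  by rewrite oner_eq0.
exists l => a /eigenvalueP [u ua u0].
have du : 0 < dot u u.
  rewrite lt_neqAle dot_ge0 andbT eq_sym.
  by apply: contra u0 => /eqP /dot_eq0 ->.
by have := Hle u; rewrite ua dotZl ler_pM2r.
Qed.

(** * Maxima of semicontinuous functions *)

(** The superlevel sets {g k <= g}, k in K, generate a proper filter on K.  It
    has a cluster point c by compactness, and g c < g x is impossible: near c
    one would have g < g x, while {g x <= g} belongs to the filter. *)
Lemma usc_attains_max (R : realType) (T : topologicalType) (g : T -> R)
    (K : set T) :
  K !=set0 -> compact K ->
  (forall x b, K x -> g x < b -> \forall y \near x, K y -> g y < b) ->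
  exists2 c, K c & forall x, K x -> g x <= g c.
Proof.
move=> [k0 Kk0] cK usc.
pose F : set_system T :=
  [set S | exists2 k, K k & [set i | K i /\ g k <= g i] `<=` S].
have FF : ProperFilter F.
  apply: Build_ProperFilter_ex.
    by move=> S [k Kk kS]; exists k; apply: kS.
  split.
  - by exists k0.
  - move=> P Q [k Kk kP] [j Kj jQ].
    have [kj|jk] := leP (g k) (g j).
      exists j => // i [Ki ji]; split; last exact: jQ.
      by apply: kP; split => //; exact: le_trans ji.
    exists k => // i [Ki ki]; split; first exact: kP.
    by apply: jQ; split => //; exact: le_trans (ltW jk) ki.
  - by move=> P Q PQ [k Kk kP]; exists k => //; exact: subset_trans PQ.
have [|c [Kc clc]] := cK F FF; first by exists k0 => // i [].
exists c => // x Kx; rewrite leNgt; apply/negP => cx.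
have [||i [[Ki xi] /(_ Ki)]] := clc [set i | K i /\ g x <= g i]
  [set y | K y -> g y < g x].
- by exists x.
- exact: usc.
by rewrite ltNge xi.
Qed.

Lemma LSC_near (R : realType) N (Omega : set 'rV[R]_N) (phi : 'rV[R]_N -> R)
    z b :
  LSC Omega phi -> Omega z -> b < phi z ->
  \forall z' \near z, Omega z' -> b < phi z'.
Proof.
move=> lsc Oz bz.
have [|V + Vb] := lsc z b; first by rewrite lte_fin.
rewrite /nbhs /= -nbhs_subspace_in// /within /= => nV.
by apply: filterS nV => z' + /[dup] Oz' => /[apply] /Vb; rewrite lte_fin.
Qed.

(** The quotient h / phi need not be upper semicontinuous where h < 0, but its
    positive part is, and the maximum is positive. *)
Lemma ratio_attains_max (R : realType) N (Omega T : set 'rV[R]_N)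
    (h phi : 'rV[R]_N -> R) :
  compact T -> T `<=` Omega -> continuous h -> LSC Omega phi ->
  (forall z, Omega z -> 0 < phi z) -> (exists2 z, T z & 0 < h z) ->
  exists2 x, T x &
    0 < h x /\ forall z, T z -> h z / phi z <= h x / phi x.
Proof.
move=> cT TO hc lsc phi0 [z0 Tz0 hz0].
pose g z := Num.max (h z) 0 / phi z.
have [x Tx gmax] : exists2 c, T c & forall z, T z -> g z <= g c.
  apply: usc_attains_max => //; first by exists z0.
  move=> z b Tz gb; have Oz := TO _ Tz; have pz := phi0 _ Oz.
  have b0 : 0 < b.
    by apply: le_lt_trans gb; rewrite divr_ge0 ?(ltW pz)// le_max lexx orbT.
  (* c separates the two sides of max(h, 0) < b phi at z, so that each side
     can be moved independently *)
  move: gb; rewrite /g ltr_pdivrMr// => /midf_lt [].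
  set c := (_ + _) / 2 => hlc clb.
  have c0 : 0 < c by apply: le_lt_trans hlc; rewrite le_max lexx orbT.
  have near_h : \forall z' \near z, h z' < c.
    apply: (cvgr_lt _ (hc z)); apply: le_lt_trans hlc.
    by rewrite le_max lexx.
  have near_phi : \forall z' \near z, Omega z' -> c / b < phi z'.
    by apply: LSC_near => //; rewrite ltr_pdivrMr// mulrC.
  apply: filterS (filterI near_h near_phi) => z' [h1 h2] Tz'.
  have Oz' := TO _ Tz'.
  rewrite ltr_pdivrMr ?phi0//; apply: (@lt_trans _ _ c).
    by rewrite gt_max h1.
  by rewrite mulrC -ltr_pdivrMr// h2.
have px := phi0 _ (TO _ Tx).
have gx0 : 0 < g x.
  apply: lt_le_trans (gmax _ Tz0).
  by apply: divr_gt0; [rewrite lt_max hz0|exact/phi0/TO].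
have hx0 : 0 < h x.
  by move: gx0; rewrite /g pmulr_lgt0 ?invr_gt0// lt_max ltxx orbF.
exists x => //; split=> // z Tz.
have -> : h x / phi x = g x by rewrite /g max_l// ltW.
apply: le_trans (gmax _ Tz); rewrite ler_pM2r; first by rewrite le_max lexx.
by rewrite invr_gt0; exact/phi0/TO.
Qed.

(** * Directional derivatives *)

Section DirectionalDerivatives.
Context {R : realType} {V : normedModType R}.
Implicit Types (f g : V -> R) (z v : V).

(** Makes the one-variable chain rule available for directional derivatives. *)
Lemma is_derive_lineP f z v df :
  is_derive z v f df <-> is_derive (0 : R) 1 (fun t : R => f (t *: v + z)) df.
Proof.
have E : 'D_v f z = 'D_1 (fun t : R => f (t *: v + z)) 0.
  rewrite /derive; set g1 := fun h => h^-1 *: _; set g2 := fun h => h^-1 *: _.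
  suff -> : g1 = g2 by [].
  by rewrite funeqE /g1 /g2 => h /=; rewrite addr0 scale0r add0r [_%:A]mulr1.
split=> -[dv <-].
  by split; [exact: (derivable1P f z v).1 dv | rewrite E].
by split; [exact: (derivable1P f z v).2 dv | rewrite E].
Qed.

Lemma is_derive_mul f g z v df dg : is_derive z v f df -> is_derive z v g dg ->
  is_derive z v (fun t => f t * g t) (f z * dg + g z * df).
Proof. by move=> hf hg; exact: (is_deriveM hf hg). Qed.

Lemma is_derive_comp_real (h : R -> R) f z v df dh :
  is_derive (f z) 1 h dh -> is_derive z v f df ->
  is_derive z v (fun t => h (f t)) (dh * df).
Proof.
move=> hh /is_derive_lineP hf; apply/is_derive_lineP.
by apply: (@is_derive1_comp _ h _ _ _ _ _ hf); rewrite scale0r add0r.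
Qed.

End DirectionalDerivatives.

(** Covers linear functionals and quadratic forms at once: along a line both are
    polynomials, of which c is the coefficient of degree one. *)
Lemma is_derive_quadratic (R : realType) (V : normedModType R) (f : V -> R)
    z v c d :
  (forall t : R, f (t *: v + z) = f z + t * c + t ^+ 2 * d) ->
  is_derive z v f c.
Proof.
move=> fE; apply/is_derive_lineP; under eq_fun do rewrite fE.
have idD := is_derive_id (0 : R) 1.
have cstD (k : R) := is_derive_cst k (0 : R) 1.
have H := is_deriveD (is_deriveD (cstD (f z)) (is_derive_mul idD (cstD c)))
  (is_derive_mul (is_derive_mul idD idD) (cstD d)).
by apply: (is_derive_eq H) => /=; ring.
Qed.

(** * The barrier *)

(** The axis is the line through [x] directed by [e]; the parameters [a] and [K]
    stand for pi / l and r^-2, and [m] for the factor which makes the barrier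
    touch the supersolution. *)
Section Barrier.
Variables (R : realType) (N : nat) (x e : 'rV[R]_N) (m a K : R).
Implicit Types (u v z : 'rV[R]_N).

Definition height z := dot (z - x) e.

(** For a unit vector [e], the orthogonal projection along [e]. *)
Definition orth_proj : 'M[R]_N := 1%:M - e^T *m e.

Definition offset z := (z - x) *m orth_proj.

(** The square of the norm of [offset z] when [e] is a unit vector
    ([sqdist_axisE]).  With a single projection, the derivative in direction v
    is 2 <offset z, v> without any assumption on [e]. *)
Definition sqdist_axis z := dot (offset z) (z - x).

Definition barrier z :=
  m * sin (a * height z) * (1 - K * sqdist_axis z).

(** The derivative of [barrier] in direction [v]. *)
Definition dbarrier v z :=
  m * (a * dot v e * cos (a * height z) * (1 - K * sqdist_axis z)
       - 2 * K * sin (a * height z) * dot (offset z) v).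

(** The derivative of [dbarrier v] in direction [u]. *)
Definition ddbarrier u v z :=
  m * (- a ^+ 2 * dot u e * dot v e * sin (a * height z) *
           (1 - K * sqdist_axis z)
       - 2 * a * K * cos (a * height z) *
           (dot v e * dot (offset z) u + dot u e * dot (offset z) v)
       - 2 * K * sin (a * height z) * dot (u *m orth_proj) v).

Lemma orth_proj_sym : orth_proj^T = orth_proj.
Proof. by rewrite /orth_proj linearB /= tr_scalar_mx trmx_mul trmxK. Qed.

Lemma mulmx_orth_proj z : z *m orth_proj = z - dot z e *: e.
Proof.
by rewrite /orth_proj mulmxBr mulmx1 mulmxA [z *m e^T]mx11_scalar mul_scalar_mx.
Qed.

Lemma height_line z v (t : R) : height (t *: v + z) = height z + t * dot v e.
Proof. by rewrite /height -addrA [LHS]dotDl dotZl; exact: addrC. Qed.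

Lemma offset_line z v (t : R) :
  offset (t *: v + z) = offset z + t *: (v *m orth_proj).
Proof. by rewrite /offset -addrA mulmxDl -scalemxAl; exact: addrC. Qed.

Lemma sqdist_axis_line z v (t : R) :
  sqdist_axis (t *: v + z) = sqdist_axis z + t * (2 * dot (offset z) v)
    + t ^+ 2 * dot (v *m orth_proj) v.
Proof.
rewrite /sqdist_axis offset_line.
have -> : t *: v + z - x = t *: v + (z - x) by rewrite addrA.
have := erefl (offset z); rewrite {1}/offset; move: (z - x) => w ow.
rewrite !(dotDl, dotDr, dotZl, dotZr) (dot_mulmxl v w) orth_proj_sym ow.
by rewrite (dotC v); ring.
Qed.

Lemma is_derive_height z v : is_derive z v height (dot v e).
Proof.
apply: (@is_derive_quadratic _ _ _ _ _ _ 0) => t.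
by rewrite height_line mulr0 addr0.
Qed.

Lemma is_derive_offset z u v :
  is_derive z u (fun z => dot (offset z) v) (dot (u *m orth_proj) v).
Proof.
by apply: (@is_derive_quadratic _ _ _ _ _ _ 0) => t;
  rewrite offset_line dotDl dotZl mulr0 addr0.
Qed.

Lemma is_derive_sin_height z v :
  is_derive z v (fun z => sin (a * height z))
    (a * dot v e * cos (a * height z)).
Proof.
have H := @is_derive_comp_real _ _ _ (fun z => a * height z) _ _ _ _
  (is_derive_sin _)
  (is_derive_mul (is_derive_cst a z v) (is_derive_height z v)).
by apply: (is_derive_eq H); rewrite mulr0 addr0 mulrC.
Qed.

Lemma is_derive_cos_height z v :
  is_derive z v (fun z => cos (a * height z))
    (- (a * dot v e * sin (a * height z))).
Proof.
have H := @is_derive_comp_real _ _ _ (fun z => a * height z) _ _ _ _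
  (is_derive_cos _)
  (is_derive_mul (is_derive_cst a z v) (is_derive_height z v)).
by apply: (is_derive_eq H); rewrite mulr0 addr0 mulNr mulrC.
Qed.

Lemma is_derive_profile z v :
  is_derive z v (fun z => 1 - K * sqdist_axis z)
    (- (2 * K * dot (offset z) v)).
Proof.
apply: (@is_derive_quadratic _ _ _ _ _ _
  (- K * dot (v *m orth_proj) v)) => t.
rewrite sqdist_axis_line; ring.
Qed.

Lemma is_derive_barrier z v : is_derive z v barrier (dbarrier v z).
Proof.
have H := is_derive_mul (is_derive_mul (is_derive_cst m z v)
  (is_derive_sin_height z v)) (is_derive_profile z v).
by apply: (is_derive_eq H); rewrite /dbarrier /=; ring.
Qed.

Lemma is_derive_dbarrier z u v : is_derive z u (dbarrier v) (ddbarrier u v z).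
Proof.
have H1 := is_derive_mul (is_derive_mul (is_derive_cst (a * dot v e) z u)
  (is_derive_cos_height z u)) (is_derive_profile z u).
have H2 := is_derive_mul (is_derive_mul (is_derive_cst (2 * K) z u)
  (is_derive_sin_height z u)) (is_derive_offset z u v).
have H := is_derive_mul (is_derive_cst m z u) (is_deriveB H1 H2).
by apply: (is_derive_eq H); rewrite /ddbarrier /=; ring.
Qed.

Lemma height_continuous : continuous height.
Proof.
rewrite [X in continuous X](_ : _ = fun z => dot z e - dot x e).
  apply: continuous_add; first exact: dotl_continuous.
  exact: cst_continuous.
by apply/funext => z; rewrite /height dotDl dotNl.
Qed.

Lemma offset_continuous v : continuous (fun z => dot (offset z) v).
Proof.
rewrite [X in continuous X](_ : _ =
    fun z => dot z (v *m orth_proj) - dot x (v *m orth_proj)).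
  apply: continuous_add; first exact: dotl_continuous.
  exact: cst_continuous.
by apply/funext => z; rewrite /offset dot_mulmxl orth_proj_sym dotDl dotNl.
Qed.

Lemma sqdist_axis_continuous : continuous sqdist_axis.
Proof.
rewrite [X in continuous X](_ : _ = fun z => dot (z *m orth_proj) z
    + (- (2 * dot z (x *m orth_proj)) + dot (x *m orth_proj) x)).
  apply: continuous_add; first exact: quad_form_continuous.
  apply: continuous_add; last exact: cst_continuous.
  apply: continuous_opp; apply: continuous_mul; first exact: cst_continuous.
  exact: dotl_continuous.
apply/funext => z; rewrite /sqdist_axis /offset mulmxBl !(dotDl, dotDr, dotNl).
rewrite !dotNr (dot_mulmxl z x) orth_proj_sym (dotC (x *m _) z); ring.
Qed.

Lemma sin_height_continuous : continuous (fun z => sin (a * height z)).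
Proof.
apply: continuous_postcomp; first exact: continuous_sin.
by apply: continuous_mul; [exact: cst_continuous|exact: height_continuous].
Qed.

Lemma cos_height_continuous : continuous (fun z => cos (a * height z)).
Proof.
apply: continuous_postcomp; first exact: continuous_cos.
by apply: continuous_mul; [exact: cst_continuous|exact: height_continuous].
Qed.

Lemma profile_continuous : continuous (fun z => 1 - K * sqdist_axis z).
Proof.
apply: continuous_add; first exact: cst_continuous.
by apply: continuous_opp; apply: continuous_mul;
  [exact: cst_continuous|exact: sqdist_axis_continuous].
Qed.

Ltac solve_continuity := lazymatch goal with
  | |- continuous (fun _ => sin _) => exact: sin_height_continuous
  | |- continuous (fun _ => cos _) => exact: cos_height_continuous
  | |- continuous (fun _ => dot (offset _) _) => exact: offset_continuous
  | |- continuous (fun _ => - _) => apply: continuous_opp; solve_continuity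
  | |- continuous (fun _ => 1 - _) => exact: profile_continuous
  | |- continuous (fun _ => _ + _) => apply: continuous_add; solve_continuity
  | |- continuous (fun _ => _ * _) =>
      first [exact: cst_continuous | apply: continuous_mul; solve_continuity]
  | |- _ => exact: cst_continuous
  end.

Lemma barrier_continuous : continuous barrier.
Proof. rewrite /barrier; solve_continuity. Qed.

Lemma dbarrier_continuous v : continuous (dbarrier v).
Proof. rewrite /dbarrier; solve_continuity. Qed.

Lemma ddbarrier_continuous u v : continuous (ddbarrier u v).
Proof. rewrite /ddbarrier; solve_continuity. Qed.

Lemma partial_barrier i : partial i barrier = dbarrier (delta_mx ord0 i).
Proof.
apply/funext => z; rewrite /partial.
by case: (is_derive_barrier z (delta_mx ord0 i)).
Qed.

Lemma partial_dbarrier i v :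
  partial i (dbarrier v) = ddbarrier (delta_mx ord0 i) v.
Proof.
apply/funext => z; rewrite /partial.
by case: (is_derive_dbarrier z (delta_mx ord0 i) v).
Qed.

Lemma barrier_C2 z : C2_near barrier z.
Proof.
suff C2 z' : [/\ {for z', continuous barrier},
    forall i : 'I_N, derivable barrier z' (delta_mx ord0 i) /\
      {for z', continuous (partial i barrier)} &
    forall i j : 'I_N, derivable (partial j barrier) z' (delta_mx ord0 i) /\
      {for z', continuous (partial i (partial j barrier))}].
  exact: (@filterE _ (nbhs (z : 'rV[R]_N)) _ _ C2).
split=> [|i|i j]; first exact: barrier_continuous.
  rewrite partial_barrier; split; last exact: dbarrier_continuous.
  by case: (is_derive_barrier z' (delta_mx ord0 i)).
rewrite !partial_barrier partial_dbarrier.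
split; last exact: ddbarrier_continuous.
by case: (is_derive_dbarrier z' (delta_mx ord0 i) (delta_mx ord0 j)).
Qed.

Lemma hessian_barrierE z : hessian barrier z =
  (- (a ^+ 2 * barrier z)) *: (e^T *m e)
  - (m * 2 * a * K * cos (a * height z)) *:
      ((offset z)^T *m e + e^T *m offset z)
  - (m * 2 * K * sin (a * height z)) *: orth_proj.
Proof.
apply/matrixP => i j; rewrite mxE partial_barrier partial_dbarrier.
rewrite /ddbarrier -!rowE /barrier !(dotC (delta_mx _ _)) !dot_delta.
rewrite !mxE !big_ord1 !mxE; ring.
Qed.

Hypothesis e_unit : dot e e = 1.

Lemma hessian_barrier_sym z : (hessian barrier z)^T = hessian barrier z.
Proof.
apply/matrixP => i j.
rewrite !mxE !partial_barrier !partial_dbarrier /ddbarrier.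
rewrite (dot_mulmxl (delta_mx _ j)) orth_proj_sym [dot _ (_ *m orth_proj)]dotC.
ring.
Qed.

(** The cutoff is constant along [e]: both the offset and the projection are
    orthogonal to [e], so that only the second derivative of the sine
    remains. *)
Lemma hessian_barrier_axis z :
  dot (e *m hessian barrier z) e = - (a ^+ 2 * barrier z).
Proof.
have eP : e *m orth_proj = 0 by rewrite mulmx_orth_proj e_unit scale1r subrr.
have bo : dot (offset z) e = 0.
  by rewrite /offset dot_mulmxl orth_proj_sym eP /dot trmx0 mulmx0 mxE.
have ee : e *m e^T = 1%:M by rewrite [LHS]mx11_scalar -/(dot e e) e_unit.
have ob : e *m (offset z)^T = 0.
  by rewrite [LHS]mx11_scalar -/(dot e _) dotC bo raddf0.
rewrite hessian_barrierE !mulmxBr -!scalemxAr mulmxDr !mulmxA.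
rewrite ee ob mul0mx !mul1mx eP.
rewrite add0r scaler0 subr0 dotDl dotNl !dotZl bo.
by rewrite e_unit mulr0 subr0 mulr1.
Qed.

Lemma barrier_le_lambda_max z :
  - (a ^+ 2 * barrier z) <= lambda_max (hessian barrier z).
Proof.
rewrite -hessian_barrier_axis; apply: rayleigh_le_lambda_max => //.
exact: hessian_barrier_sym.
Qed.

End Barrier.

(** * Thin tubes around a segment *)

Lemma sqdist_axisE (R : realType) N (x e z : 'rV[R]_N) : dot e e = 1 ->
  sqdist_axis x e z = dot (offset x e z) (offset x e z).
Proof.
move=> e1; rewrite /sqdist_axis {3}/offset mulmx_orth_proj.
rewrite [RHS]dotDr dotNr dotZr.
have -> : dot (offset x e z) e = 0; last by rewrite mulr0 subr0.
by rewrite /offset mulmx_orth_proj dotDl dotNl dotZl e1 mulr1 subrr.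
Qed.

Definition tube (R : realType) N (x e : 'rV[R]_N) (l r : R) : set 'rV[R]_N :=
  [set z | 0 <= height x e z <= l /\ sqdist_axis x e z <= r ^+ 2].

(** A point of the tube lies on the translate, by its offset from the axis, of
    the segment from [x] to [x + l *: e]; the translated endpoints lie in
    [Omega]. *)
Lemma tube_sub (R : realType) N (Omega : set 'rV[R]_N) (x e : 'rV[R]_N)
    (l r : R) :
  convex_set Omega -> dot e e = 1 -> 0 < l -> 0 <= r ->
  (forall w, `|w| <= r -> Omega (x + w)) ->
  (forall w, `|w| <= r -> Omega (x + l *: e + w)) ->
  tube x e l r `<=` Omega.
Proof.
move=> Oconv e1 l0 r0 Ox Oy z [/andP[s0 sl] qr].
set w := offset x e z.
have wr : `|w| <= r by apply: mx_norm_le => //; rewrite -sqdist_axisE.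
have t0 : 0 <= height x e z / l by rewrite divr_ge0 // ltW.
have t1 : height x e z / l <= 1 by rewrite ler_pdivrMr// mul1r.
have := Oconv _ _ (Itv01 t0 t1) (mem_set (Oy _ wr)) (mem_set (Ox _ wr)).
move=> /set_mem; congr (Omega _).
have wE : z = x + height x e z *: e + w.
  rewrite /w /offset mulmx_orth_proj -/(height x e z) -addrA.
  by rewrite [_ *: e + _]addrC subrK [RHS]addrC subrK.
rewrite [RHS]wE /conv /= /unstable.onem.
rewrite -[in RHS](divfK (lt0r_neq0 l0) (height x e z)).
by apply/rowP => i; rewrite !mxE; ring.
Qed.

Lemma tube_closed (R : realType) N (x e : 'rV[R]_N) (l r : R) :
  closed (tube x e l r).
Proof.
have -> : tube x e l r = height x e @^-1` [set` `[0, l]] `&`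
    sqdist_axis x e @^-1` [set t | t <= r ^+ 2].
  by apply/seteqP; split=> z; rewrite /tube /= in_itv.
apply: closedI; apply: preimage_closed.
- by move=> z _; exact: height_continuous.
- exact: itv_closed.
- by move=> z _; exact: sqdist_axis_continuous.
- exact: closed_le.
Qed.

Lemma tube_nbhs (R : realType) N (x e z : 'rV[R]_N) (l r : R) :
  0 < height x e z < l -> sqdist_axis x e z < r ^+ 2 ->
  \forall z' \near z, tube x e l r z'.
Proof.
move=> /andP[s0 sl] qr.
near=> z'; split; last by apply: ltW; near: z'; apply: cvgr_lt qr;
  exact: sqdist_axis_continuous.
by rewrite !ltW//; near: z'; [apply: cvgr_lt sl|apply: cvgr_gt s0];
  exact: height_continuous.
Unshelve. all: by end_near. Qed.

Lemma open_normP (R : realType) N (Omega : set 'rV[R]_N) p :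
  open Omega -> Omega p ->
  exists2 d : R, 0 < d & forall w, `|w| <= d -> Omega (p + w).
Proof.
move=> Oopen Op.
have /nbhs_normP [d /= d0 dO] : nbhs p Omega by exact: open_nbhs_nbhs.
exists (d / 2); first by rewrite divr_gt0.
move=> w wd; apply: dO; rewrite /ball_ /= opprD addrA subrr sub0r normrN.
by apply: le_lt_trans wd _; rewrite ltr_pdivrMr// ltr_pMr// ltr1n.
Qed.

Lemma exists_tube (R : realType) N (Omega : set 'rV[R]_N) (x e : 'rV[R]_N)
    (l : R) :
  open Omega -> convex_set Omega -> dot e e = 1 -> 0 < l ->
  Omega x -> Omega (x + l *: e) ->
  exists2 r : R, 0 < r & tube x e l r `<=` Omega.
Proof.
move=> Oopen Oconv e1 l0 Ox Oy.
have [d1 d10 Od1] := open_normP Oopen Ox.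
have [d2 d20 Od2] := open_normP Oopen Oy.
exists (Num.min d1 d2); first by rewrite lt_min d10.
apply: tube_sub => //; first by rewrite le_min !ltW.
  by move=> w wr; apply: Od1; apply: le_trans wr _; rewrite ge_min lexx.
by move=> w wr; apply: Od2; apply: le_trans wr _; rewrite ge_min lexx orbT.
Qed.

Lemma tube_nbhs_of_barrier_gt0 (R : realType) N (x e z : 'rV[R]_N) (l r : R) :
  0 < l -> 0 < r -> tube x e l r z -> 0 < barrier x e 1 (pi / l) (r ^- 2) z ->
  \forall z' \near z, tube x e l r z'.
Proof.
move=> l0 r0 [/andP[s0 sl] qr] h0.
have nz (t : R) : height x e z = t -> sin (pi / l * t) != 0.
  move=> st; apply/eqP => sin_eq0; move: h0.
  by rewrite /barrier st sin_eq0 mulr0 mul0r ltxx.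
apply: tube_nbhs.
  rewrite !lt_neqAle s0 sl !andbT; apply/andP; split; apply/eqP => E.
    by have := nz _ (esym E); rewrite mulr0 sin0 eqxx.
  by have := nz _ E; rewrite (divfK (lt0r_neq0 l0)) sinpi eqxx.
rewrite lt_neqAle qr andbT; apply/eqP => E.
move: h0; rewrite /barrier E mulVf ?subrr ?mulr0 ?ltxx//.
by rewrite expf_neq0// gt_eqF.
Qed.

(** * Comparison *)

Lemma barrier_scale (R : realType) N (x e z : 'rV[R]_N) (m a K : R) :
  barrier x e m a K z = m * barrier x e 1 a K z.
Proof. by rewrite /barrier mul1r mulrA. Qed.

(** If psi = m h touches phi from below at x0, the supersolution property and
    the bound on lambda_max give mu phi(x0) <= a^2 psi(x0), and the common value
    phi(x0) = psi(x0) > 0 cancels. *)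
Lemma supersolution_le (R : realType) N (Omega : set 'rV[R]_N)
    (phi : 'rV[R]_N -> R) (mu : R) (x y : 'rV[R]_N) :
  open Omega -> bounded_set Omega -> convex_set Omega ->
  LSC Omega phi -> (forall z, Omega z -> 0 < phi z) ->
  viscosity_supersolution Omega mu phi ->
  Omega x -> Omega y -> mu * enorm (x - y) ^+ 2 <= pi ^+ 2.
Proof.
move=> Oopen Obnd Oconv lsc phi0 visc Ox Oy.
have [->|xy] := eqVneq x y.
  rewrite subrr enorm_dot dotE big1 ?mulr0 ?sqr_ge0// => i _.
  by rewrite mxE mul0r.
set l := enorm (x - y).
have l0 : 0 < l.
  rewrite lt_neqAle sqrtr_ge0 andbT eq_sym; apply: contra xy => /eqP lz.
  by rewrite -subr_eq0; apply/eqP/dot_eq0; rewrite -enorm_dot -/l lz expr0n.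
pose e := l^-1 *: (y - x).
have e1 : dot e e = 1.
  rewrite /e dotZl dotZr -(opprB x) dotNl dotNr opprK -enorm_dot -/l.
  by field; rewrite gt_eqF.
have yE : x + l *: e = y.
  by rewrite /e scalerA divff ?gt_eqF// scale1r addrC subrK.
have [r r0 TO] : exists2 r : R, 0 < r & tube x e l r `<=` Omega.
  by apply: exists_tube => //; rewrite yE.
have cT : compact (tube x e l r).
  apply: bounded_closed_compact; last exact: tube_closed.
  by case: Obnd => M [Mr MO]; exists M; split=> // t Mt z /TO; exact: MO.
pose a := pi / l; pose K := r ^- 2.
pose h := barrier x e 1 a K.
have [x0 Tx0 [hx0 hmax]] : exists2 x0, tube x e l r x0 &
    0 < h x0 /\ forall z, tube x e l r z -> h z / phi z <= h x0 / phi x0.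
  apply: (ratio_attains_max cT TO _ lsc phi0).
    exact: barrier_continuous.
  (* the midpoint of the segment, where the sine equals 1 *)
  pose z0 := x + (l / 2) *: e.
  have z0x : z0 - x = (l / 2) *: e by rewrite /z0 addrC addKr.
  have z0s : height x e z0 = l / 2 by rewrite /height z0x dotZl e1 mulr1.
  have z0q : sqdist_axis x e z0 = 0.
    rewrite /sqdist_axis /offset mulmx_orth_proj -/(height _ _ _) z0s.
    by rewrite z0x subrr -(scale0r 0) dotZl mul0r.
  exists z0.
    rewrite /tube /= z0s z0q sqr_ge0; split => //.
    by rewrite divr_ge0 ?ltW//= ltr_pdivrMr// ltr_pMr// ltr1n.
  rewrite /h /barrier z0s z0q mulr0 subr0 mulr1 mul1r.
  have -> : a * (l / 2) = pi / 2 by rewrite /a; field; rewrite gt_eqF.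
  by rewrite sin_pihalf.
have Ox0 := TO _ Tx0; have px0 := phi0 _ Ox0.
pose m := phi x0 / h x0; pose psi := barrier x e m a K.
have psiE z : psi z = m * h z by rewrite /psi barrier_scale.
have touch : phi x0 = psi x0 by rewrite psiE divfK// gt_eqF.
have below : \forall z \near x0, phi x0 - psi x0 <= phi z - psi z.
  apply: filterS (tube_nbhs_of_barrier_gt0 l0 r0 Tx0 hx0) => z Tz.
  have pz := phi0 _ (TO _ Tz).
  rewrite touch subrr subr_ge0 psiE.
  have -> : phi z = m * (h x0 / phi x0 * phi z).
    by rewrite /m; field; rewrite !gt_eqF.
  by rewrite ler_pM2l ?divr_gt0// -ler_pdivrMr// hmax.
have visc_x0 := visc x0 psi Ox0 (barrier_C2 _ _ _ _ _ _) below touch.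
have := @barrier_le_lambda_max _ _ x e m a K e1 x0; rewrite -/psi -touch => eig.
have : mu * phi x0 <= a ^+ 2 * phi x0 by lra.
by rewrite ler_pM2r// /a expr_div_n ler_pdivlMr// exprn_gt0.
Qed.

Theorem theorem1p1 (R : realType) (N : nat) (N_gt0 : (0 < N)%N)
    (Omega : set 'rV[R]_N) (Omega_open : open Omega)
    (Omega_bounded : bounded_set Omega) (Omega_convex : convex_set Omega)
    (Omega_nonempty : Omega !=set0) :
  (mu1 Omega <= (pi ^+ 2 / diam Omega ^+ 2)%:E)%E.
Proof.
apply: ge_ereal_sup => _ [mu [phi [lsc phi0 visc]] <-]; rewrite lee_fin.
have bound x y : Omega x -> Omega y -> mu * enorm (x - y) ^+ 2 <= pi ^+ 2.
  exact: (supersolution_le Omega_open Omega_bounded Omega_convex lsc phi0).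
have [mu0|mu0] := leP mu 0.
  by apply: le_trans mu0 _; rewrite divr_ge0 ?sqr_ge0.
pose D := pi / Num.sqrt mu.
have smu : 0 < Num.sqrt mu by rewrite sqrtr_gt0.
have ubD : ubound [set enorm (x - y) | x in Omega & y in Omega] D.
  move=> _ [x Ox [y Oy <-]].
  rewrite /D ler_pdivlMr// -ler_sqr ?nnegrE ?mulr_ge0 ?sqrtr_ge0 ?pi_ge0//.
  by rewrite exprMn (sqr_sqrtr (ltW mu0)) mulrC bound.
have [x Ox] := Omega_nonempty.
(* division by a zero diameter would give 0 on the right-hand side *)
have diam0 : 0 < diam Omega.
  have [d d0 dO] := open_normP Omega_open Ox.
  pose w : 'rV[R]_N := d *: delta_mx ord0 (Ordinal N_gt0).
  have dw : dot w w = d ^+ 2.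
    by rewrite /w dotZl dotZr dot_delta mxE !eqxx mulr1 expr2.
  have Oxw : Omega (x + w) by apply: dO; apply: mx_norm_le; rewrite ?dw// ltW.
  apply: (@lt_le_trans _ _ (enorm (x + w - x))).
    rewrite [x + w]addrC addrK lt_neqAle sqrtr_ge0 andbT eq_sym.
    by rewrite -sqrf_eq0 enorm_dot dw sqrf_eq0 gt_eqF.
  apply: ub_le_sup; first by exists D.
  by exists (x + w) => //; exists x.
have diamD : diam Omega <= D.
  by apply: ge_sup => //; exists (enorm (x - x)), x => //; exists x.
rewrite ler_pdivlMr ?exprn_gt0//.
have : diam Omega * Num.sqrt mu <= pi by rewrite -ler_pdivlMr.
rewrite -ler_sqr ?nnegrE ?mulr_ge0 ?sqrtr_ge0 ?pi_ge0 ?(ltW diam0)//.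
by rewrite exprMn (sqr_sqrtr (ltW mu0)) mulrC.
Qed.
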